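(* Let $H_1,H_2$ be complex Hilbert spaces, with their inner products $\langle-\mid-\rangle\colon\overline{H_i}\otimes H_i\to\mathbb{C}$ as comparison relations in $\mathbf{Vect}_{\mathbb{C}}$. There is a bijective correspondence between tame relations $r\colon\overline{H_1}\otimes H_2\to\mathbb{C}$ and bounded linear maps $f\colon H_1\to H_2$. As a result, $\mathbf{Hilb}=\mathrm{TRel}(\mathbf{Vect}_{\mathbb{C}},\langle-\mid-\rangle)$, where $\langle-\mid-\rangle$ is the comparison cluster $\big(\langle-\mid-\rangle_H\colon\overline{H}\otimes H\to\mathbb{C}\big)_{H\in\mathbf{Hilb}}$ indexed by Hilbert spaces.
   Context: $\mathbf{Vect}_{\mathbb{C}}$ is the category of complex vector spaces and linear maps, with the usual (algebraic) tensor product; its involution sends $V$ to the conjugate space $\overline{V}$, with the same vectors and addition but scalar multiplication $s\cdot_{\overline{V}}v=\overline{s}\cdot_V v$. Inner products are antilinear in the first and linear in the second argument, so they are linear maps $\overline{H}\otimes H\to\mathbb{C}$. $\mathbf{Hilb}$ is the category of complex Hilbert spaces and bounded (equivalently, continuous) linear maps, with the adjoint as dagger. A linear map $r\colon\overline{H_1}\otimes H_2\to\mathbb{C}$ is a tame relation if there are (necessarily unique) linear maps $r_*\colon H_1\to H_2$ and $r^*\colon H_2\to H_1$ with $\langle r_*(x)\mid y\rangle=r(x,y)=\langle x\mid r^*(y)\rangle$ for all $x\in H_1,y\in H_2$. $\mathrm{TRel}(\mathbf{Vect}_{\mathbb{C}},\langle-\mid-\rangle)$ is the dagger category with Hilbert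 spaces as objects, tame relations $r\colon\overline{H_1}\otimes H_2\to\mathbb{C}$ as morphisms $H_1\to H_2$, inner products as identities, composition $(s\bullet r)(x,z)=s(r_*(x),z)$, and dagger $r^\dagger(y,x)=\langle r^*(y)\mid x\rangle$. The equality of categories is understood as an isomorphism via the bijective correspondence. *)

(* Defs.v *)
From HB Require Import structures.
From mathcomp Require Import all_boot all_order all_algebra.
From mathcomp Require Import generic_quotient complex ring lra.
From mathcomp Require Import all_classical all_reals.
From mathcomp Require Import topology normedtype.

Set Implicit Arguments.
Unset Strict Implicit.
Unset Printing Implicit Defensive.

Import Order.TTheory GRing.Theory Num.Theory.
Import numFieldNormedType.Exports.

Local Open Scope ring_scope.
Local Open Scope quotient_scope.

Lemma linear_ext (K : pzRingType) (U : lmodType K) (V : zmodType)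
    (s : K -> V -> V) (f g : {linear U -> V | s}) : f =1 g -> f = g.
Proof.
move=> /funext; case: f => f cf; case: g => g cg /= fg.
case: _ / fg cg => -[[b1] [b2]] ; case: cf => -[a1] [a2].
by rewrite (Prop_irrelevance a1 b1) (Prop_irrelevance a2 b2).
Qed.

(* The algebraic tensor product, by generators and relations: a list of pairs
   [:: (u1, v1); ...; (un, vn)] stands for the formal sum of the ui (x) vi,
   and [tensor_rel] is the least congruence making (x) bilinear. *)
Inductive tensor_rel (K : comNzRingType) (U V : lmodType K) :
    seq (U * V) -> seq (U * V) -> Prop :=
| tensor_refl s : tensor_rel s s
| tensor_sym s t : tensor_rel s t -> tensor_rel t s
| tensor_trans s t w : tensor_rel s t -> tensor_rel t w -> tensor_rel s w
| tensor_cat s s' t t' :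
    tensor_rel s s' -> tensor_rel t t' -> tensor_rel (s ++ t) (s' ++ t')
| tensor_comm s t : tensor_rel (s ++ t) (t ++ s)
| tensor_addl u u' v : tensor_rel [:: (u + u', v)] [:: (u, v); (u', v)]
| tensor_addr u v v' : tensor_rel [:: (u, v + v')] [:: (u, v); (u, v')]
| tensor_scale a u v : tensor_rel [:: (a *: u, v)] [:: (u, a *: v)]
| tensor_zero v : tensor_rel [:: (0, v)] [::].

Section TensorProduct.
Variables (K : comNzRingType) (U V : lmodType K).

Definition tensor_eqb (s t : seq (U * V)) : bool := `[< tensor_rel s t >].

Fact tequiv_refl : reflexive tensor_eqb.
Proof. by move=> s; apply/asboolP; constructor. Qed.

Fact tequiv_sym : symmetric tensor_eqb.
Proof.
by move=> s t; apply/asboolP/asboolP => h; apply: tensor_sym.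
Qed.

Fact tequiv_trans : transitive tensor_eqb.
Proof.
move=> t s w /asboolP st /asboolP tw; apply/asboolP.
exact: tensor_trans st tw.
Qed.

Definition tensor_equiv : equiv_rel (seq (U * V)) :=
  EquivRel tensor_eqb tequiv_refl tequiv_sym tequiv_trans.

Definition tensor : Type := {eq_quot tensor_equiv}.

HB.instance Definition _ := EqQuotient.on tensor.
HB.instance Definition _ := Choice.on tensor.

Definition tcls (s : seq (U * V)) : tensor := \pi_tensor s.

Fact tclsP s t : tcls s = tcls t <-> tensor_rel s t.
Proof.
split=> [/eqP|st].
  by rewrite eqmodE => /asboolP.
by apply/eqP; rewrite eqmodE; apply/asboolP.
Qed.

Fact tclsK s : tensor_rel (repr (tcls s)) s.
Proof. by apply/tclsP; rewrite /tcls reprK. Qed.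

Fact tclsE (x : tensor) : exists s, x = tcls s.
Proof. by exists (repr x); rewrite /tcls reprK. Qed.

Definition tscale_seq (a : K) (s : seq (U * V)) :=
  [seq (a *: p.1, p.2) | p <- s].

Fact tscale_seq_rel a s t :
  tensor_rel s t -> tensor_rel (tscale_seq a s) (tscale_seq a t).
Proof.
elim=> {s t} /=.
- by move=> s; exact: tensor_refl.
- by move=> s t _; exact: tensor_sym.
- by move=> s t w _ st _ tw; exact: tensor_trans st tw.
- by move=> s s' t t' _ ss' _ tt'; rewrite /tscale_seq !map_cat; exact: tensor_cat.
- by move=> s t; rewrite /tscale_seq !map_cat; exact: tensor_comm.
- by move=> u u' v; rewrite scalerDr; exact: tensor_addl.
- by move=> u v v'; exact: tensor_addr.
- by move=> b u v; rewrite scalerA mulrC -scalerA; exact: tensor_scale.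
- by move=> v; rewrite scaler0; exact: tensor_zero.
Qed.

Definition tadd (x y : tensor) : tensor := tcls (repr x ++ repr y).
Definition tscale (a : K) (x : tensor) : tensor := tcls (tscale_seq a (repr x)).
Definition topp (x : tensor) : tensor := tscale (-1) x.

Fact taddE s t : tadd (tcls s) (tcls t) = tcls (s ++ t).
Proof. by apply/tclsP/tensor_cat; exact: tclsK. Qed.

Fact tscaleE a s : tscale a (tcls s) = tcls (tscale_seq a s).
Proof. by apply/tclsP/tscale_seq_rel/tclsK. Qed.

Fact taddA : associative tadd.
Proof.
move=> x y z; have [s ->] := tclsE x; have [t ->] := tclsE y.
by have [w ->] := tclsE z; rewrite !taddE catA.
Qed.

Fact taddC : commutative tadd.
Proof.
move=> x y; have [s ->] := tclsE x; have [t ->] := tclsE y.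
by rewrite !taddE; apply/tclsP; exact: tensor_comm.
Qed.

Fact tadd0 : left_id (tcls [::]) tadd.
Proof. by move=> x; have [s ->] := tclsE x; rewrite taddE. Qed.

Fact tscaleDl x : {morph tscale^~ x : a b / a + b >-> tadd a b}.
Proof.
move=> a b; have [s ->] := tclsE x; rewrite !tscaleE taddE; apply/tclsP.
elim: s => [|[u v] s ih] /=; first exact: tensor_refl.
rewrite scalerDl.
apply: (tensor_trans (tensor_cat (tensor_addl _ _ _) ih)).
apply: (@tensor_cat _ _ _ [:: _] [:: _]); first exact: tensor_refl.
rewrite -cat_rcons -cats1 -cat_cons -cat1s; apply: tensor_cat.
  exact: tensor_comm.
exact: tensor_refl.
Qed.

Fact tscale1 : left_id 1 tscale.
Proof.
move=> x; have [s ->] := tclsE x; rewrite tscaleE; congr tcls.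
by rewrite -[RHS]map_id; apply: eq_map => -[u v] /=; rewrite scale1r.
Qed.

Fact tscale0 x : tscale 0 x = tcls [::].
Proof.
have [s ->] := tclsE x; rewrite tscaleE; apply/tclsP.
elim: s => [|[u v] s ih] /=; first exact: tensor_refl.
rewrite scale0r; apply: (@tensor_cat _ _ _ [:: _] [::]) ih.
exact: tensor_zero.
Qed.

Fact taddN : left_inverse (tcls [::]) topp tadd.
Proof.
by move=> x; rewrite -[X in tadd _ X]tscale1 -tscaleDl addNr tscale0.
Qed.

HB.instance Definition _ :=
  GRing.isZmodule.Build tensor taddA taddC tadd0 taddN.

Fact tcls_add s t : tcls s + tcls t = tcls (s ++ t).
Proof. exact: taddE. Qed.

Fact tscaleA a b x : tscale a (tscale b x) = tscale (a * b) x.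
Proof.
have [s ->] := tclsE x; rewrite !tscaleE /tscale_seq -map_comp; congr tcls.
by apply: eq_map => -[u v] /=; rewrite scalerA.
Qed.

Fact tscaleDr : right_distributive tscale +%R.
Proof.
move=> a x y; have [s ->] := tclsE x; have [t ->] := tclsE y.
by rewrite tcls_add !tscaleE tcls_add /tscale_seq map_cat.
Qed.

HB.instance Definition _ :=
  GRing.Zmodule_isLmodule.Build K tensor tscaleA tscale1 tscaleDr tscaleDl.

Fact tcls_scale a s : a *: tcls s = tcls (tscale_seq a s).
Proof. exact: tscaleE. Qed.

Definition tens (u : U) (v : V) : tensor := \pi_tensor [:: (u, v)].

Fact tensE u v : tens u v = tcls [:: (u, v)].
Proof. by []. Qed.

Lemma tens_is_bilinear :
  bilinear_for ( *:%R : K -> tensor -> tensor) *:%R tens.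
Proof.
split=> [v a u u' | u a v v']; rewrite /= !tensE tcls_scale tcls_add.
  by apply/tclsP/tensor_addl.
apply/tclsP; apply: tensor_trans (tensor_addr _ _ _) _.
apply: (@tensor_cat _ _ _ [:: _] [:: _]).
  exact/tensor_sym/tensor_scale.
exact: tensor_refl.
Qed.

HB.instance Definition _ :=
  bilinear_isBilinear.Build K U V tensor *:%R *:%R tens tens_is_bilinear.

Lemma tensor_ind (P : tensor -> Prop) :
  P 0 -> (forall u v x, P x -> P (tens u v + x)) -> forall x, P x.
Proof.
move=> P0 PD x; have [s ->] := tclsE x; elim: s => [|[u v] s ih] //.
by have := PD u v _ ih; rewrite tensE tcls_add.
Qed.

Lemma tensor_linear_ext (W : zmodType) (s : K -> W -> W)
    (f g : {linear tensor -> W | s}) :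
  (forall u v, f (tens u v) = g (tens u v)) -> f = g.
Proof.
move=> fg; apply: linear_ext => x; elim/tensor_ind: x => [|u v x ih].
  by rewrite !raddf0.
by rewrite !raddfD /= fg ih.
Qed.

Section Lift.
Variables (W : lmodType K) (b : {bilinear U -> V -> W}).

Definition tlift_seq (s : seq (U * V)) : W := \sum_(p <- s) b p.1 p.2.

Fact tlift_rel s t : tensor_rel s t -> tlift_seq s = tlift_seq t.
Proof.
elim=> {s t} //=; rewrite /tlift_seq.
- by move=> s t w _ -> _ ->.
- by move=> s s' t t' _ ss' _ tt'; rewrite !big_cat /= ss' tt'.
- by move=> s t; rewrite !big_cat /= addrC.
- by move=> u u' v; rewrite !big_cons !big_nil /= !addr0 linearDl.
- by move=> u v v'; rewrite !big_cons !big_nil /= !addr0 linearDr.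
- by move=> a u v; rewrite !big_seq1 /= linearZl_LR linearZr_LR.
- by move=> v; rewrite big_seq1 big_nil linear0l.
Qed.

Definition tensor_lift_fun (x : tensor) : W :=
  \sum_(p <- repr x) b p.1 p.2.

Fact tliftE s : tensor_lift_fun (tcls s) = tlift_seq s.
Proof. exact/tlift_rel/tclsK. Qed.

Lemma tensor_lift_is_linear : linear tensor_lift_fun.
Proof.
move=> a x y; have [s ->] := tclsE x; have [t ->] := tclsE y.
rewrite tcls_scale tcls_add !tliftE.
rewrite /tlift_seq big_cat big_map scaler_sumr; congr (_ + _).
by apply: eq_bigr => p _; rewrite linearZl_LR.
Qed.

HB.instance Definition _ :=
  GRing.isLinear.Build K tensor W *:%R tensor_lift_fun tensor_lift_is_linear.

Definition tensor_lift : {linear tensor -> W} := tensor_lift_fun.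

Lemma tensor_liftE u v : tensor_lift (tens u v) = b u v.
Proof. by rewrite /tensor_lift /= tensE tliftE /tlift_seq big_seq1. Qed.

Lemma tensor_lift_unique (f : {linear tensor -> W}) :
  (forall u v, f (tens u v) = b u v) -> f = tensor_lift.
Proof. by move=> fE; apply: tensor_linear_ext => u v; rewrite fE tensor_liftE. Qed.

End Lift.
End TensorProduct.

Section TensorMap.
Variables (K : comNzRingType) (U U' V V' : lmodType K).
Variables (f : {linear U -> U'}) (g : {linear V -> V'}).

Definition tens_comp (u : U) (v : V) : tensor U' V' := tens (f u) (g v).

Lemma tens_comp_is_bilinear :
  bilinear_for ( *:%R : K -> tensor U' V' -> tensor U' V') *:%R tens_comp.
Proof.
split=> [v a u u' | u a v v']; rewrite /= /tens_comp linearP.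
  by rewrite linearPl.
by rewrite linearPr.
Qed.

HB.instance Definition _ :=
  bilinear_isBilinear.Build K U V (tensor U' V') *:%R *:%R
    tens_comp tens_comp_is_bilinear.

Definition tensor_map : {linear tensor U V -> tensor U' V'} :=
  tensor_lift tens_comp.

Lemma tensor_mapE u v : tensor_map (tens u v) = tens (f u) (g v).
Proof. exact: tensor_liftE. Qed.

End TensorMap.

Section ConjugateSpace.
Variables (C : numClosedFieldType) (V : lmodType C).

Definition conj_space : Type := V.

HB.instance Definition _ := GRing.Zmodule.on conj_space.

Definition conj_scale (a : C) (v : conj_space) : conj_space :=
  a^* *: (v : V).

Fact conj_scaleA a b v : conj_scale a (conj_scale b v) = conj_scale (a * b) v.
Proof. by rewrite /conj_scale scalerA rmorphM. Qed.

Fact conj_scale1 : left_id 1 conj_scale.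
Proof. by move=> v; rewrite /conj_scale rmorph1 scale1r. Qed.

Fact conj_scaleDr : right_distributive conj_scale +%R.
Proof. by move=> a u v; rewrite /conj_scale -scalerDr. Qed.

Fact conj_scaleDl v : {morph conj_scale^~ v : a b / a + b}.
Proof. by move=> a b; rewrite /conj_scale rmorphD scalerDl. Qed.

HB.instance Definition _ := GRing.Zmodule_isLmodule.Build C conj_space
  conj_scaleA conj_scale1 conj_scaleDr conj_scaleDl.

End ConjugateSpace.

Section ConjugateMap.
Variables (C : numClosedFieldType) (V W : lmodType C) (f : {linear V -> W}).

Definition conj_map_fun (v : conj_space V) : conj_space W := f (v : V).

Fact conj_map_is_linear : linear conj_map_fun.
Proof. by move=> a u v; rewrite /conj_map_fun linearD linearZ. Qed.

HB.instance Definition _ := GRing.isLinear.Build C (conj_space V)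
  (conj_space W) *:%R conj_map_fun conj_map_is_linear.

Definition conj_map : {linear conj_space V -> conj_space W} := conj_map_fun.

End ConjugateMap.

(* [rel_val r x y] is written r(x, y) on paper; a pair (x, y) with x : V only
   denotes an element of conj_space V (x) W through this wrapper. *)
Definition rel_val (C : numClosedFieldType) (V W : lmodType C)
    (r : {scalar tensor (conj_space V) W}) (x : V) (y : W) : C :=
  r (tens (x : conj_space V) y).

Lemma rel_ext (C : numClosedFieldType) (V W : lmodType C)
    (r s : {scalar tensor (conj_space V) W}) :
  (forall (x : V) (y : W), rel_val r x y = rel_val s x y) -> r = s.
Proof. by move=> rs; apply: tensor_linear_ext => u v; exact: rs. Qed.

(* The norm of a normedModType over R[i] takes (real) values in R[i], and
   [inner_norm] says that the inner product is positive definite and induces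
   the complete norm of the space. *)
Record hilbert (R : realType) := Hilbert {
  hilbert_space :> completeNormedModType R[i];
  inner : {scalar tensor (conj_space hilbert_space) hilbert_space};
  inner_conj : forall x y : hilbert_space,
    rel_val inner y x = (rel_val inner x y)^*;
  inner_norm : forall x : hilbert_space, rel_val inner x x = `|x| ^+ 2 }.

Definition ip (R : realType) (H : hilbert R) (x y : H) : R[i] :=
  rel_val (inner H) x y.

Section InnerProduct.
Variables (R : realType) (H : hilbert R).
Implicit Types (x y z : H) (a : R[i]) (t : R).

Lemma ipC x y : ip y x = (ip x y)^*.
Proof. exact: inner_conj. Qed.

Lemma ip_norm x : ip x x = `|x| ^+ 2.
Proof. exact: inner_norm. Qed.

Lemma ipDr x y z : ip x (y + z) = ip x y + ip x z.
Proof. by rewrite /ip /rel_val linearDr linearD. Qed.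

Lemma ipZr a x y : ip x (a *: y) = a * ip x y.
Proof. by rewrite /ip /rel_val linearZr_LR linearZ. Qed.

Lemma ipDl x y z : ip (x + y) z = ip x z + ip y z.
Proof. by rewrite ![ip _ z]ipC ipDr rmorphD. Qed.

Lemma ipZl a x y : ip (a *: x) y = a^* * ip x y.
Proof. by rewrite ![ip _ y]ipC ipZr rmorphM. Qed.

Lemma ipNr x y : ip x (- y) = - ip x y.
Proof. by rewrite -scaleN1r ipZr mulN1r. Qed.

Lemma ipNl x y : ip (- x) y = - ip x y.
Proof. by rewrite ![ip _ y]ipC ipNr rmorphN. Qed.

Lemma ip_inj x y : (forall z, ip z x = ip z y) -> x = y.
Proof.
move=> xy; apply/eqP; rewrite -subr_eq0 -normr_eq0 -sqrf_eq0 -ip_norm.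
by rewrite ipDr ipNr xy subrr.
Qed.

Definition rip x y : R := complex.Re (ip x y).
Definition rnorm x : R := complex.Re `|x|.

Lemma rnormE x : `|x| = (rnorm x)%:C%C.
Proof. by rewrite /rnorm RRe_real // realE normr_ge0. Qed.

Lemma rnorm_ge0 x : 0 <= rnorm x.
Proof. by rewrite -lecR -rnormE normr_ge0. Qed.

Lemma rip_norm x : rip x x = rnorm x ^+ 2.
Proof. by rewrite /rip ip_norm rnormE -rmorphXn. Qed.

Lemma ripC x y : rip y x = rip x y.
Proof. by rewrite /rip ipC; case: (ip x y). Qed.

Lemma ripDr x y z : rip x (y + z) = rip x y + rip x z.
Proof. by rewrite /rip ipDr raddfD. Qed.

Lemma ripNr x y : rip x (- y) = - rip x y.
Proof. by rewrite /rip ipNr raddfN. Qed.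

Lemma ripZr t x y : rip x (t%:C%C *: y) = t * rip x y.
Proof.
by rewrite /rip ipZr; case: (ip x y) => a b /=; rewrite mul0r subr0.
Qed.

Lemma ripDl x y z : rip (x + y) z = rip x z + rip y z.
Proof. by rewrite ![rip _ z]ripC ripDr. Qed.

Lemma ripNl x y : rip (- x) y = - rip x y.
Proof. by rewrite ![rip _ y]ripC ripNr. Qed.

Lemma ripZl t x y : rip (t%:C%C *: x) y = t * rip x y.
Proof. by rewrite ![rip _ y]ripC ripZr. Qed.

Definition ripE := (ripDl, ripDr, ripNl, ripNr, ripZl, ripZr).

Lemma rnorm_eq0 x : rnorm x = 0 -> x = 0.
Proof. by move=> x0; apply/eqP; rewrite -normr_eq0 rnormE x0. Qed.

Lemma rip0r x : rip x 0 = 0.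
Proof. by rewrite -(subrr x) ripDr ripNr subrr. Qed.

Lemma rip_CS x y : rip x y ^+ 2 <= rnorm x ^+ 2 * rnorm y ^+ 2.
Proof.
have [/eqP/rnorm_eq0 ->|y0] := boolP (rnorm y == 0).
  by rewrite rip0r expr0n /= mulr_ge0 ?sqr_ge0.
have y2 : 0 < rnorm y ^+ 2 by rewrite exprn_even_gt0.
have := sqr_ge0 (rnorm (x - (rip x y / rnorm y ^+ 2)%:C%C *: y)).
rewrite -[rnorm (x - _) ^+ 2]rip_norm !ripE !rip_norm [rip y x]ripC => h.
rewrite -ler_pdivrMr // -subr_ge0; apply: le_trans h _.
by rewrite le_eqVlt; apply/orP; left; apply/eqP; field.
Qed.

Lemma rip_le x y : `|rip x y| <= rnorm x * rnorm y.
Proof.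
by rewrite -(@ler_pXn2r _ 2) ?nnegrE ?mulr_ge0 ?rnorm_ge0 //
  real_normK ?num_real // exprMn rip_CS.
Qed.

Section Riesz.
Variables (phi : {scalar H}) (M : R).
Hypothesis phiM : forall x, `|complex.Re (phi x)| <= M * rnorm x.

Let J x := rnorm x ^+ 2 - 2 * complex.Re (phi x).
Let d := inf (range J).

Let J_lb x : - M ^+ 2 <= J x.
Proof.
have := phiM x; rewrite ler_norml /J => /andP[_ h].
have := sqr_ge0 (rnorm x - M); rewrite sqrrB; nra.
Qed.

Let d_le x : d <= J x.
Proof.
by apply: ge_inf; [exists (- M ^+ 2) => _ [y _ <-]; exact: J_lb|exists x].
Qed.

Let J_approx (e : R) : 0 < e -> exists x, J x < d + e.
Proof.
move=> e0; have [|_ [x _ <-] xd] := @inf_adherent _ (range J) e e0.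
  split; first by exists (J 0), 0.
  by exists (- M ^+ 2) => _ [y _ <-]; exact: J_lb.
by exists x.
Qed.

Let phiZ (t : R) x : complex.Re (phi (t%:C%C *: x)) = t * complex.Re (phi x).
Proof.
by rewrite linearZ /=; case: (phi x) => a b /=; rewrite mul0r subr0.
Qed.

Let J_cauchy x y : rnorm (x - y) ^+ 2 <= 2 * (J x - d) + 2 * (J y - d).
Proof.
have := d_le ((2^-1)%:C%C *: (x + y)).
rewrite /J phiZ raddfD raddfD -!rip_norm !ripE [rip y x]ripC => h.
by rewrite /=; nra.
Qed.

Let J_var x v : (rip x v - complex.Re (phi v)) ^+ 2 <= (J x - d) * rnorm v ^+ 2.
Proof.
have [/eqP/rnorm_eq0 ->|v0] := boolP (rnorm v == 0).
  by rewrite rip0r !raddf0 /= addr0 expr0n /= mulr_ge0 ?sqr_ge0 // subr_ge0.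
have v2 : 0 < rnorm v ^+ 2 by rewrite exprn_even_gt0.
pose t := - (rip x v - complex.Re (phi v)) / rnorm v ^+ 2.
have := d_le (x + t%:C%C *: v).
rewrite /J !raddfD /= phiZ -[rnorm (_ + _) ^+ 2]rip_norm !ripE !rip_norm.
rewrite [rip v x]ripC => h.
rewrite -ler_pdivrMr // -subr_ge0; move: h; rewrite -subr_ge0 => h.
apply: le_trans h _; rewrite /t le_eqVlt; apply/orP; left; apply/eqP.
by field.
Qed.

Lemma riesz_exists : exists z, forall x, ip z x = phi x.
Proof.
have /choice [u uP] : forall n : nat, exists x, J x < d + n.+1%:R^-1.
  by move=> n; apply: J_approx; rewrite invr_gt0.
have small (e : R) : 0 < e -> exists N, forall n, (N <= n)%N ->
    J (u n) - d < e.
  move=> e0; exists (Num.trunc e^-1) => n Nn.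
  rewrite ltrBlDl; apply: lt_le_trans (uP n) _; rewrite lerD2l.
  rewrite invf_ple ?posrE // ltW //.
  by apply: lt_le_trans (truncnS_gt _) _; rewrite ler_nat ltnS.
have cu : cauchy (u @ \oo)%classic.
  apply: cauchy_exP => eps eps0.
  have e0 : 0 < complex.Re eps by rewrite -ltcR RRe_real // gtr0_real.
  set e := complex.Re eps in e0 *.
  have [N NP] := small (e ^+ 2 / 4) ltac:(by rewrite divr_gt0 // exprn_gt0).
  exists (u N); exists N => // n /= Nn.
  rewrite -ball_normE /ball_ /= rnormE -[eps]RRe_real ?gtr0_real // ltcR.
  rewrite -(@ltr_pXn2r _ 2) ?nnegrE ?rnorm_ge0 ?(ltW e0) //.
  apply: le_lt_trans (J_cauchy _ _) _.
  have := NP N (leqnn N); have := NP n Nn; rewrite -/e; lra.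
have /cvg_ex [z /= uz] : cvg (u @ \oo)%classic by exact: cauchy_cvg.
have near_z (e : R) : 0 < e -> exists n, J (u n) - d < e /\
    rnorm (z - u n) ^+ 2 < e.
  move=> e0; have [N NP] := small e e0.
  have se0 : 0 < (Num.sqrt e)%:C%C :> R[i] by rewrite ltcR sqrtr_gt0.
  have /cvgrPdist_lt /(_ _ se0) [m _ mP] := uz.
  exists (maxn N m); split; first by apply: NP; rewrite leq_maxl.
  have := mP (maxn N m); rewrite /= leq_maxr rnormE ltcR => /(_ isT) h.
  by rewrite -[ltRHS]sqr_sqrtr ?(ltW e0) // ltr_pXn2r ?nnegrE ?rnorm_ge0 ?sqrtr_ge0.
have zRe v : rip z v = complex.Re (phi v).
  apply/eqP; rewrite -subr_eq0 -sqrf_eq0 eq_le sqr_ge0 andbT leNgt.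
  apply/negP; set b := _ - _ => b0.
  set V2 := rnorm v ^+ 2; have V0 : 0 <= V2 by exact: sqr_ge0.
  have [|n [n1 n2]] := near_z (b ^+ 2 / (8 * (V2 + 1))).
    by rewrite divr_gt0 // mulr_gt0 // ltr_wpDl.
  set e := _ / _ in n1 n2.
  have h1 := J_var (u n) v; have h2 := rip_CS (z - u n) v.
  have bE : b = (rip (u n) v - complex.Re (phi v)) + rip (z - u n) v.
    by rewrite ripDl ripNl /b; ring.
  have eE : b ^+ 2 = e * (8 * (V2 + 1)).
    by rewrite /e divfK // mulf_neq0 // gt_eqF // ltr_wpDl.
  have e0 : 0 < e by rewrite /e divr_gt0 // mulr_gt0 // ltr_wpDl.
  have h3 : (rip (u n) v - complex.Re (phi v)) ^+ 2 <= e * V2.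
    by apply: le_trans h1 _; rewrite ler_wpM2r // ltW.
  have h4 : rip (z - u n) v ^+ 2 <= e * V2.
    by apply: le_trans h2 _; rewrite ler_wpM2r // ltW.
  have : b ^+ 2 <= 4 * (e * V2).
    have sq (p q : R) : (p + q) ^+ 2 <= 2 * p ^+ 2 + 2 * q ^+ 2.
      by have := sqr_ge0 (p - q); rewrite sqrrB sqrrD; lra.
    by rewrite bE; apply: le_trans (sq _ _) _; lra.
  by rewrite eE; nra.
exists z => x; apply/eqP; rewrite eq_complex; apply/andP; split; apply/eqP.
  exact: zRe.
have := zRe ('i%C *: x); rewrite /rip ipZr linearZ /=.
case: (ip z x) => p q; case: (phi x) => p' q' /=.
by rewrite !mul0r !mul1r !sub0r => /oppr_inj.
Qed.
End Riesz.
End InnerProduct.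

(* A morphism of [Hom A B] goes from A to B, and [compm g f] is g after f. *)
Record dagger_category := DaggerCategory {
  Ob :> Type;
  Hom : Ob -> Ob -> Type;
  idm : forall A, Hom A A;
  compm : forall A B C, Hom B C -> Hom A B -> Hom A C;
  dag : forall A B, Hom A B -> Hom B A;
  comp_assoc : forall A B C D (h : Hom C D) (g : Hom B C) (f : Hom A B),
    compm h (compm g f) = compm (compm h g) f;
  comp_idl : forall A B (f : Hom A B), compm (idm B) f = f;
  comp_idr : forall A B (f : Hom A B), compm f (idm A) = f;
  dag_id : forall A, dag (idm A) = idm A;
  dag_comp : forall A B C (g : Hom B C) (f : Hom A B),
    dag (compm g f) = compm (dag f) (dag g);
  dagK : forall A B (f : Hom A B), dag (dag f) = f }.

Arguments Hom {_} A B.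
Arguments idm {_} A.
Arguments compm {_ A B C} g f.
Arguments dag {_ A B} f.

Definition is_dagger_functor (C D : dagger_category) (Fo : C -> D)
    (Fm : forall A B : C, Hom A B -> Hom (Fo A) (Fo B)) : Prop :=
  [/\ forall A : C, Fm A A (idm A) = idm (Fo A),
      forall (A B E : C) (g : Hom B E) (f : Hom A B),
        Fm A E (compm g f) = compm (Fm B E g) (Fm A B f)
    & forall (A B : C) (f : Hom A B), Fm B A (dag f) = dag (Fm A B f)].

Record dagger_functor (C D : dagger_category) := DaggerFunctor {
  fob : C -> D;
  fmor : forall A B : C, Hom A B -> Hom (fob A) (fob B);
  fmorP : is_dagger_functor fmor }.

Fact id_is_dagger_functor (C : dagger_category) :
  @is_dagger_functor C C id (fun A B f => f).
Proof. by []. Qed.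

Definition dagger_functor_id (C : dagger_category) : dagger_functor C C :=
  DaggerFunctor (@id_is_dagger_functor C).

Fact comp_is_dagger_functor (C D E : dagger_category)
    (G : dagger_functor D E) (F : dagger_functor C D) :
  @is_dagger_functor C E (fun A => fob G (fob F A))
    (fun A B f => fmor G (fmor F f)).
Proof.
have [Fi Fc Fd] := fmorP F; have [Gi Gc Gd] := fmorP G.
by split=> *; rewrite ?Fi ?Gi ?Fc ?Gc ?Fd ?Gd.
Qed.

Definition dagger_functor_comp (C D E : dagger_category)
    (G : dagger_functor D E) (F : dagger_functor C D) : dagger_functor C E :=
  DaggerFunctor (comp_is_dagger_functor G F).

Definition dagger_isomorphism (C D : dagger_category)
    (F : dagger_functor C D) : Prop :=
  exists G : dagger_functor D C,
    dagger_functor_comp G F = dagger_functor_id C /\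
    dagger_functor_comp F G = dagger_functor_id D.

Section TameRelations.
Variable R : realType.
Implicit Types H : hilbert R.

Definition is_tame H1 H2 (r : {scalar tensor (conj_space H1) H2})
    (f : {linear H1 -> H2}) (g : {linear H2 -> H1}) : Prop :=
  forall (x : H1) (y : H2),
    ip (f x) y = rel_val r x y /\ rel_val r x y = ip x (g y).

Record tame_relation H1 H2 := TameRelation {
  tame_rel :> {scalar tensor (conj_space H1) H2};
  tameP : exists f g, is_tame tame_rel f g }.

(* r_* and r^*; see [is_tame_unique] for uniqueness. *)
Definition lower H1 H2 (r : tame_relation H1 H2) : {linear H1 -> H2} :=
  projT1 (cid (tameP r)).

Definition upper H1 H2 (r : tame_relation H1 H2) : {linear H2 -> H1} :=
  projT1 (cid (projT2 (cid (tameP r)))).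

Lemma ip_lower H1 H2 (r : tame_relation H1 H2) (x : H1) (y : H2) :
  ip (lower r x) y = rel_val r x y.
Proof. by have [] := projT2 (cid (projT2 (cid (tameP r)))) x y. Qed.

Lemma ip_upper H1 H2 (r : tame_relation H1 H2) (x : H1) (y : H2) :
  ip x (upper r y) = rel_val r x y.
Proof. by have [] := projT2 (cid (projT2 (cid (tameP r)))) x y. Qed.

Lemma is_tame_unique H1 H2 (r : tame_relation H1 H2) f g :
  is_tame r f g -> f = lower r /\ g = upper r.
Proof.
move=> fg; split; apply: linear_ext => x; apply: ip_inj => z.
  by rewrite ipC [RHS]ipC ip_lower; have [->] := fg x z.
by rewrite ip_upper; have [_ ->] := fg z x.
Qed.

Lemma tame_ext H1 H2 (r s : tame_relation H1 H2) :
  (forall (x : H1) (y : H2), rel_val r x y = rel_val s x y) -> r = s.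
Proof.
case: r => r rP; case: s => s sP /= /rel_ext rs.
by case: _ / rs sP => sP; rewrite (Prop_irrelevance rP sP).
Qed.

Lemma tame_id_subproof H : exists f g, is_tame (inner H) f g.
Proof. by exists idfun, idfun. Qed.

Definition tame_id H : tame_relation H H := TameRelation (tame_id_subproof H).

(* (s . r)(x, z) = s(r_* x, z); see [tame_comp_relE]. *)
Definition tame_comp_rel H1 H2 H3 (s : tame_relation H2 H3)
    (r : tame_relation H1 H2) : {scalar tensor (conj_space H1) H3} :=
  s \o tensor_map (conj_map (lower r)) (idfun : {linear H3 -> H3}).

Lemma tame_comp_relE H1 H2 H3 (s : tame_relation H2 H3)
    (r : tame_relation H1 H2) (x : H1) (z : H3) :
  rel_val (tame_comp_rel s r) x z = rel_val s (lower r x) z.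
Proof. by rewrite /rel_val /= tensor_mapE. Qed.

Lemma tame_comp_subproof H1 H2 H3 (s : tame_relation H2 H3)
    (r : tame_relation H1 H2) : exists f g, is_tame (tame_comp_rel s r) f g.
Proof.
exists (lower s \o lower r), (upper r \o upper s) => x z.
rewrite tame_comp_relE; split; first exact: ip_lower.
by rewrite -[RHS]/(ip x (upper r (upper s z))) ip_upper -[RHS]ip_lower ip_upper.
Qed.

Definition tame_comp H1 H2 H3 (s : tame_relation H2 H3)
    (r : tame_relation H1 H2) : tame_relation H1 H3 :=
  TameRelation (tame_comp_subproof s r).

(* r^dagger(y, x) = <r^* y | x>; see [tame_dagger_relE]. *)
Definition tame_dagger_rel H1 H2 (r : tame_relation H1 H2) :
    {scalar tensor (conj_space H2) H1} :=
  inner H1 \o tensor_map (conj_map (upper r)) (idfun : {linear H1 -> H1}).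

Lemma tame_dagger_relE H1 H2 (r : tame_relation H1 H2) (y : H2) (x : H1) :
  rel_val (tame_dagger_rel r) y x = ip (upper r y) x.
Proof. by rewrite /ip /rel_val /= tensor_mapE. Qed.

Lemma tame_dagger_subproof H1 H2 (r : tame_relation H1 H2) :
  exists f g, is_tame (tame_dagger_rel r) f g.
Proof.
exists (upper r), (lower r) => y x; rewrite tame_dagger_relE; split=> //.
by rewrite ipC [RHS]ipC ip_upper ip_lower.
Qed.

Definition tame_dagger H1 H2 (r : tame_relation H1 H2) : tame_relation H2 H1 :=
  TameRelation (tame_dagger_subproof r).

Lemma tame_compE H1 H2 H3 (s : tame_relation H2 H3) (r : tame_relation H1 H2)
    (x : H1) (z : H3) : rel_val (tame_comp s r) x z = rel_val s (lower r x) z.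
Proof. exact: tame_comp_relE. Qed.

Lemma tame_daggerE H1 H2 (r : tame_relation H1 H2) (y : H2) (x : H1) :
  rel_val (tame_dagger r) y x = ip (upper r y) x.
Proof. exact: tame_dagger_relE. Qed.

Lemma lower_id H (x : H) : lower (tame_id H) x = x.
Proof. by apply: ip_inj => z; rewrite ipC [RHS]ipC ip_lower. Qed.

Lemma lower_comp H1 H2 H3 (s : tame_relation H2 H3) (r : tame_relation H1 H2)
    (x : H1) : lower (tame_comp s r) x = lower s (lower r x).
Proof.
by apply: ip_inj => z; rewrite ipC [RHS]ipC !ip_lower tame_compE.
Qed.

Lemma lower_dagger H1 H2 (r : tame_relation H1 H2) (y : H2) :
  lower (tame_dagger r) y = upper r y.
Proof. by apply: ip_inj => z; rewrite ipC [RHS]ipC ip_lower tame_daggerE. Qed.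

Lemma upper_dagger H1 H2 (r : tame_relation H1 H2) (x : H1) :
  upper (tame_dagger r) x = lower r x.
Proof.
by apply: ip_inj => z; rewrite ip_upper tame_daggerE ipC ip_upper -ip_lower -ipC.
Qed.

Fact tame_compA A B C D (h : tame_relation C D) (g : tame_relation B C)
    (f : tame_relation A B) :
  tame_comp h (tame_comp g f) = tame_comp (tame_comp h g) f.
Proof. by apply: tame_ext => x y; rewrite !tame_compE lower_comp. Qed.

Fact tame_idl A B (f : tame_relation A B) : tame_comp (tame_id B) f = f.
Proof. by apply: tame_ext => x y; rewrite tame_compE; exact: ip_lower. Qed.

Fact tame_idr A B (f : tame_relation A B) : tame_comp f (tame_id A) = f.
Proof. by apply: tame_ext => x y; rewrite tame_compE lower_id. Qed.

Fact tame_dagger_id A : tame_dagger (tame_id A) = tame_id A.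
Proof.
apply: tame_ext => x y; rewrite tame_daggerE ipC ip_upper.
by rewrite -[LHS]/((ip y x)^*) -ipC.
Qed.

Fact tame_dagger_comp A B C (g : tame_relation B C) (f : tame_relation A B) :
  tame_dagger (tame_comp g f) = tame_comp (tame_dagger f) (tame_dagger g).
Proof.
apply: tame_ext => x y; rewrite tame_compE !tame_daggerE lower_dagger.
by rewrite ipC [RHS]ipC !ip_upper tame_compE -ip_upper ip_lower.
Qed.

Fact tame_daggerK A B (f : tame_relation A B) :
  tame_dagger (tame_dagger f) = f.
Proof.
by apply: tame_ext => x y; rewrite tame_daggerE upper_dagger ip_lower.
Qed.

Definition TRel : dagger_category :=
  DaggerCategory tame_compA tame_idl tame_idr
    tame_dagger_id tame_dagger_comp tame_daggerK.

End TameRelations.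

Section BoundedLinearMaps.
Variable R : realType.
Implicit Types H : hilbert R.

(* By [linear_bounded_continuous], the bounded linear maps are the continuous
   ones. *)
Record bounded_linear H1 H2 := BoundedLinear {
  blin :> {linear H1 -> H2};
  blinP : bounded_near blin (nbhs (0 : H1)) }.

Lemma blin_ext H1 H2 (f g : bounded_linear H1 H2) : blin f =1 blin g -> f = g.
Proof.
case: f => f fP; case: g => g gP /= /linear_ext fg.
by case: _ / fg gP => gP; rewrite (Prop_irrelevance fP gP).
Qed.

Lemma bounded_rnormP H1 H2 (f : {linear H1 -> H2}) :
  bounded_near f (nbhs (0 : H1)) <->
  exists2 M : R, 0 <= M & forall x, rnorm (f x) <= M * rnorm x.
Proof.
rewrite linear_boundedP; split=> [/pinfty_ex_gt0[M M0 fM]|[M M0 fM]].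
  exists (complex.Re M); first by rewrite -lecR RRe_real ?ltW ?gtr0_real.
  move=> x; rewrite -lecR rmorphM /= -!rnormE RRe_real ?gtr0_real //.
exists M%:C%C; split; first by rewrite ger0_real // lecR.
move=> K MK x; apply: le_trans (_ : M%:C%C * `|x| <= _).
  by rewrite !rnormE -rmorphM lecR.
by rewrite ler_wpM2r // ltW.
Qed.

Lemma bounded_id_subproof H : bounded_near (idfun : {linear H -> H}) (nbhs 0).
Proof. by apply/bounded_rnormP; exists 1 => // x; rewrite mul1r. Qed.

Definition bounded_id H : bounded_linear H H :=
  BoundedLinear (bounded_id_subproof H).

Lemma bounded_comp_subproof H1 H2 H3 (g : bounded_linear H2 H3)
    (f : bounded_linear H1 H2) :
  bounded_near (g \o f : {linear H1 -> H3}) (nbhs 0).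
Proof.
have /bounded_rnormP[M M0 gM] := blinP g.
have /bounded_rnormP[N N0 fN] := blinP f.
apply/bounded_rnormP; exists (M * N); first exact: mulr_ge0.
by move=> x; rewrite -mulrA (le_trans (gM _)) // ler_wpM2l.
Qed.

Definition bounded_comp H1 H2 H3 (g : bounded_linear H2 H3)
    (f : bounded_linear H1 H2) : bounded_linear H1 H3 :=
  BoundedLinear (bounded_comp_subproof g f).

Definition is_adjoint H1 H2 (f : bounded_linear H1 H2)
    (g : bounded_linear H2 H1) : Prop :=
  forall (x : H1) (y : H2), ip (f x) y = ip x (g y).

Section Adjoint.
Variables (H1 H2 : hilbert R) (f : bounded_linear H1 H2).

Definition ip_comp (y : H2) (x : H1) : R[i] := ip y (f x).

Fact ip_comp_is_scalar y : scalar (ip_comp y).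
Proof. by move=> a u v; rewrite /ip_comp linearP ipDr ipZr. Qed.

HB.instance Definition _ y := GRing.isLinear.Build R[i] H1 R[i] *%R
  (ip_comp y) (ip_comp_is_scalar y).

Lemma adjoint_pointwise y : exists z : H1, forall x : H1, ip z x = ip y (f x).
Proof.
have /bounded_rnormP[M M0 fM] := blinP f.
apply: (@riesz_exists _ H1 (ip_comp y) (rnorm y * M)) => x.
apply: le_trans (rip_le y (f x)) _.
by rewrite -mulrA ler_wpM2l ?rnorm_ge0.
Qed.

Lemma adjoint_exists : exists g : bounded_linear H2 H1, is_adjoint f g.
Proof.
have [g gP] := choice adjoint_pointwise.
have gE (x : H1) y : ip (f x) y = ip x (g y) by rewrite ipC -gP -ipC.
have glin : linear g.
  move=> a u v; apply: ip_inj => x.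
  by rewrite -gE ipDr ipZr ipDr ipZr !gE.
pose gl : {linear H2 -> H1} := HB.pack g (GRing.isLinear.Build _ _ _ _ g glin).
have gb : bounded_near gl (nbhs 0).
  have /bounded_rnormP[M M0 fM] := blinP f.
  apply/bounded_rnormP; exists M => // y.
  have [->|] := eqVneq (rnorm (gl y)) 0; first by rewrite mulr_ge0 ?rnorm_ge0.
  move=> gy0; have gy : 0 < rnorm (gl y) by rewrite lt_neqAle eq_sym gy0 rnorm_ge0.
  rewrite -(ler_pM2l gy) -expr2 -rip_norm [rip _ _]/(complex.Re _) /= -gE.
  apply: le_trans (ler_norm _) _; apply: le_trans (rip_le _ _) _.
  by rewrite mulrA ler_wpM2r ?rnorm_ge0 // mulrC fM.
by exists (BoundedLinear gb).
Qed.

Definition adjoint : bounded_linear H2 H1 := projT1 (cid adjoint_exists).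

Lemma adjointP : is_adjoint f adjoint.
Proof. exact: projT2 (cid adjoint_exists). Qed.

Lemma adjoint_unique g : is_adjoint f g -> g = adjoint.
Proof.
move=> fg; apply: blin_ext => y; apply: ip_inj => x.
by rewrite -fg adjointP.
Qed.

End Adjoint.

Fact bounded_compA A B C D (h : bounded_linear C D) (g : bounded_linear B C)
    (f : bounded_linear A B) :
  bounded_comp h (bounded_comp g f) = bounded_comp (bounded_comp h g) f.
Proof. exact: blin_ext. Qed.

Fact bounded_idl A B (f : bounded_linear A B) :
  bounded_comp (bounded_id B) f = f.
Proof. exact: blin_ext. Qed.

Fact bounded_idr A B (f : bounded_linear A B) :
  bounded_comp f (bounded_id A) = f.
Proof. exact: blin_ext. Qed.

Fact adjoint_id A : adjoint (bounded_id A) = bounded_id A.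
Proof. by apply/esym/adjoint_unique. Qed.

Fact adjoint_comp A B C (g : bounded_linear B C) (f : bounded_linear A B) :
  adjoint (bounded_comp g f) = bounded_comp (adjoint f) (adjoint g).
Proof.
apply/esym/adjoint_unique => x y.
by rewrite -[LHS]/(ip (g (f x)) y) (adjointP g) (adjointP f).
Qed.

Fact adjointK A B (f : bounded_linear A B) : adjoint (adjoint f) = f.
Proof.
by apply/esym/adjoint_unique => x y; rewrite ipC [RHS]ipC (adjointP f).
Qed.

Definition Hilb : dagger_category :=
  DaggerCategory bounded_compA bounded_idl bounded_idr
    adjoint_id adjoint_comp adjointK.

End BoundedLinearMaps.

(* Main.v *)
Require Import Defs.
From mathcomp Require Import all_boot all_order all_algebra.
From mathcomp Require Import all_classical all_reals.
From mathcomp Require Import complex lra topology normedtype.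

(* The map [r |-> lower r] lands in bounded maps by the Hellinger-Toeplitz
   theorem: if <f x | y> = <x | g y>, then the set of all f x with |x| <= 1 is
   weakly bounded, since |<y | f x>| = |<g y | x>| <= |g y|, hence bounded by
   the uniform boundedness principle. The latter is obtained without Baire's
   theorem, by a gliding hump: if |v_n| >= 4^n, put
   u_n = u_(n-1) +- 3^-n v_n / |v_n| with the sign making |<u_n | v_n>| at
   least 3^-n |v_n|; the limit x of u is within 3^-n / 2 of u_n, so that
   |<x | v_n>| >= (4/3)^n / 2 is unbounded. The inverse map sends a bounded f
   to <f - | ->, which is tame because f has an adjoint. *)

Set Implicit Arguments.
Unset Strict Implicit.
Unset Printing Implicit Defensive.

Import Order.TTheory GRing.Theory Num.Theory.
Import numFieldNormedType.Exports.

Local Open Scope ring_scope.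

(** * Norm estimates and uniform boundedness in a Hilbert space *)

Section HilbertNorm.
Variables (R : realType) (H : hilbert R).
Implicit Types (x y : H) (t : R).

Lemma rnormD x y : rnorm (x + y) <= rnorm x + rnorm y.
Proof. by rewrite -lecR rmorphD /= -!rnormE ler_normD. Qed.

Lemma rnormZ t x : rnorm (t%:C%C *: x) = `|t| * rnorm x.
Proof.
apply: complexI; rewrite rmorphM /= -!rnormE normrZ normc_def /=.
by rewrite expr0n /= addr0 sqrtr_sqr.
Qed.

Lemma rnormN x : rnorm (- x) = rnorm x.
Proof. by rewrite /rnorm normrN. Qed.

Lemma rnorm0 : rnorm (0 : H) = 0.
Proof. by rewrite /rnorm normr0. Qed.

Lemma geometric_cvg (u : nat -> H) :
  (forall n, rnorm (u n.+1 - u n) <= 3^-1 ^+ n.+1) ->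
  exists x, forall n, rnorm (x - u n) <= 3^-1 ^+ n / 2.
Proof.
move=> uS; have q0 n : 0 < 3^-1 ^+ n :> R by rewrite exprn_gt0 // invr_gt0.
(* The tail [3^-1 ^+ (n + k) / 2] is subtracted so that the induction telescopes:
   [3^-(m+1) = 3^-m / 2 - 3^-(m+1) / 2]. *)
have dist n k :
    rnorm (u (n + k)%N - u n) <= 3^-1 ^+ n / 2 - 3^-1 ^+ (n + k) / 2.
  elim: k => [|k ih]; first by rewrite addn0 !subrr rnorm0.
  rewrite addnS -(subrK (u (n + k)%N) (u _.+1)) -addrA.
  apply: le_trans (rnormD _ _) _.
  by have := uS (n + k)%N; rewrite exprS; lra.
have near_dist n m : (n <= m)%N -> rnorm (u m - u n) <= 3^-1 ^+ n / 2.
  move=> /subnKC <-; have := dist n (m - n)%N.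
  by have := q0 (n + (m - n))%N; lra.
have small (e : R) : 0 < e -> exists n, 3^-1 ^+ n / 2 < e.
  move=> e0; exists (Num.truncn e^-1).+1.
  have lt_pow n : n%:R < 3 ^+ n :> R.
    by rewrite -natrX ltr_nat ltn_expl.
  apply: (@lt_trans _ _ (3^-1 ^+ (Num.truncn e^-1).+1)).
    by have := q0 (Num.truncn e^-1).+1; lra.
  rewrite exprVn invf_plt ?posrE ?exprn_gt0 //.
  exact: lt_trans (truncnS_gt _) (lt_pow _).
have cu : cauchy (u @ \oo)%classic.
  apply: cauchy_exP => eps eps0.
  have e0 : 0 < complex.Re eps by rewrite -ltcR RRe_real // gtr0_real.
  have [N NP] := small _ e0.
  exists (u N); exists N => // n /= Nn.
  rewrite -ball_normE /ball_ /= rnormE -[eps]RRe_real ?gtr0_real // ltcR.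
  by rewrite -rnormN opprB; apply: le_lt_trans (near_dist _ _ Nn) NP.
have /cvg_ex [x /= ux] : cvg (u @ \oo)%classic by exact: cauchy_cvg.
exists x => n; apply/ler_addgt0Pr => e e0.
have ec0 : 0 < e%:C%C :> R[i] by rewrite ltcR.
have /cvgrPdist_lt /(_ _ ec0) [m _ mP] := ux.
(* This index is past [m], hence [e]-close to [x], and past [n], so that [near_dist] applies. *)
have := mP (maxn m n); rewrite /= leq_maxl rnormE ltcR => /(_ isT) xm.
rewrite -(subrK (u (maxn m n)) x) -addrA.
apply: le_trans (rnormD _ _) _.
by have := near_dist n _ (leq_maxr m n); lra.
Qed.

(** Moving [x] by [e] along the unit vector of [v], with the sign of [rip x v], makes the two
    contributions add up instead of cancelling. *)
Lemma rip_shift (e : R) x v : 0 <= e -> v != 0 ->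
  exists y, rnorm (y - x) <= e /\ e * rnorm v <= `|rip y v|.
Proof.
move=> e0 v0; have vn : rnorm v != 0 by apply: contra_neq v0; exact: rnorm_eq0.
pose s : R := if 0 <= rip x v then 1 else -1.
have ns : `|s| = 1 by rewrite /s; case: ifP => _; rewrite ?normrN normr1.
exists (x + (s * e / rnorm v)%:C%C *: v); split.
  rewrite addrC addKr rnormZ !normrM ns normfV !ger0_norm ?rnorm_ge0 //.
  by rewrite mul1r divfK.
rewrite !ripE rip_norm expr2 mulrA divfK // -mulrA.
have h : 0 <= e * rnorm v by rewrite mulr_ge0 ?rnorm_ge0.
rewrite /s; case: ifPn => [p|]; last rewrite -ltNge => p.
  by rewrite ger0_norm; lra.
by rewrite ler0_norm; lra.
Qed.

Lemma gliding_hump (v : nat -> H) : (forall n, 4 ^+ n <= rnorm (v n)) ->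
  exists x, forall n, (4 / 3) ^+ n.+1 / 2 <= `|rip x (v n.+1)|.
Proof.
move=> vn; have v0 n : v n != 0.
  apply: contraTneq (vn n) => ->.
  by rewrite rnorm0 -ltNge exprn_gt0.
have q0 n : 0 <= 3^-1 ^+ n :> R by rewrite exprn_ge0 // invr_ge0.
(* [F (n, y)] moves [y] by at most [3^-n] to create a hump against [v n]. The start [u 0 = 0]
   carries no hump, hence the index [n.+1] in the conclusion. *)
have /choice [F FP] (p : nat * H) := rip_shift p.2 (q0 p.1) (v0 p.1).
pose u := fix u n := if n is m.+1 then F (n, u m) else 0.
have [x xP] : exists x, forall n, rnorm (x - u n) <= 3^-1 ^+ n / 2.
  by apply: geometric_cvg => n; have [] := FP (n.+1, u n).
exists x => n; have [_ /=] := FP (n.+1, u n).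
rewrite -[F _]/(u n.+1) => hu.
(* All later moves together destroy at most half of the hump. *)
have hx : `|rip (x - u n.+1) (v n.+1)| <= 3^-1 ^+ n.+1 / 2 * rnorm (v n.+1).
  by apply: le_trans (rip_le _ _) _; rewrite ler_wpM2r ?rnorm_ge0.
have tri : `|rip (u n.+1) (v n.+1)| <=
    `|rip x (v n.+1)| + `|rip (x - u n.+1) (v n.+1)|.
  rewrite ripDl ripNl -{1}(subKr (rip x (v n.+1)) (rip (u n.+1) _)).
  exact: ler_normB.
have pow : (4 / 3) ^+ n.+1 <= 3^-1 ^+ n.+1 * rnorm (v n.+1) :> R.
  by rewrite exprMn mulrC ler_wpM2l.
lra.
Qed.

Lemma weakly_bounded (A : set H) :
  (forall x, exists M, forall v, A v -> `|rip x v| <= M) ->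
  exists2 M, 0 <= M & forall v, A v -> rnorm v <= M.
Proof.
move=> wb; apply: contrapT => nb.
have /choice [v vP] : forall n : nat, exists v, A v /\ 4 ^+ n <= rnorm v.
  move=> n; apply: contrapT => nv; apply: nb; exists (4 ^+ n).
    exact: exprn_ge0.
  move=> v Av; rewrite leNgt; apply/negP => /ltW nv'.
  by apply: nv; exists v.
have [x xP] := gliding_hump (fun n => (vP n).2).
have [M MP] := wb x.
(* Bernoulli's inequality: for [n > 6 * M] it gives [(4 / 3) ^+ n / 2 >= n / 6 > M], against the
   weak bound at [x]. *)
have bern n : n%:R / 3 <= (4 / 3) ^+ n :> R.
  elim: n => [|n ih]; first by rewrite mul0r expr0.
  have : 1 <= (4 / 3) ^+ n :> R by rewrite exprn_ege1 //; lra.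
  by rewrite exprS -(natr1 n); lra.
have := MP _ (vP (Num.truncn (6 * M)).+1).1; have := xP (Num.truncn (6 * M)).
by have := bern (Num.truncn (6 * M)).+1; have := truncnS_gt (6 * M); lra.
Qed.

End HilbertNorm.

Lemma hellinger_toeplitz (R : realType) (H1 H2 : hilbert R)
    (f : {linear H1 -> H2}) (g : H2 -> H1) :
  (forall x y, ip (f x) y = ip x (g y)) -> bounded_near f (nbhs (0 : H1)).
Proof.
move=> fg; apply/bounded_rnormP.
have [|M M0 MP] := @weakly_bounded R H2 [set f x | x in [set x | rnorm x <= 1]].
  move=> y; exists (rnorm (g y)) => _ [x /= x1 <-].
  rewrite ripC /rip fg; apply: le_trans (rip_le _ _) _.
  by rewrite -[leRHS]mul1r ler_wpM2r ?rnorm_ge0.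
exists M => // x; have [x0|x0] := eqVneq (rnorm x) 0.
  by rewrite (rnorm_eq0 x0) linear0 !rnorm0 mulr0.
have xp : 0 < rnorm x by rewrite lt_neqAle eq_sym x0 rnorm_ge0.
have : rnorm (f ((rnorm x)^-1%:C%C *: x)) <= M.
  apply: MP; exists ((rnorm x)^-1%:C%C *: x) => //=.
  by rewrite rnormZ gtr0_norm ?invr_gt0 // mulVf.
by rewrite linearZ /= rnormZ gtr0_norm ?invr_gt0 // mulrC ler_pdivrMr.
Qed.

(** * The bijection between tame relations and bounded maps, and its functoriality *)

Section Correspondence.
Variable R : realType.
Implicit Types H : hilbert R.

Lemma lower_bounded H1 H2 (r : tame_relation H1 H2) :
  bounded_near (lower r) (nbhs (0 : H1)).
Proof.
apply: (@hellinger_toeplitz _ _ _ _ (upper r)) => x y.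
by rewrite ip_lower ip_upper.
Qed.

Definition bounded_of_tame H1 H2 (r : tame_relation H1 H2) :
    bounded_linear H1 H2 :=
  BoundedLinear (lower_bounded r).

Definition bounded_rel H1 H2 (f : bounded_linear H1 H2) :
    {scalar tensor (conj_space H1) H2} :=
  inner H2 \o tensor_map (conj_map f) (idfun : {linear H2 -> H2}).

Lemma bounded_relE H1 H2 (f : bounded_linear H1 H2) (x : H1) (y : H2) :
  rel_val (bounded_rel f) x y = ip (f x) y.
Proof. by rewrite /ip /rel_val /= tensor_mapE. Qed.

Lemma bounded_rel_tame H1 H2 (f : bounded_linear H1 H2) :
  is_tame (bounded_rel f) f (adjoint f).
Proof. by move=> x y; rewrite bounded_relE; split=> //; exact: adjointP. Qed.

Definition tame_of_bounded H1 H2 (f : bounded_linear H1 H2) :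
    tame_relation H1 H2 :=
  TameRelation (ex_intro _ _ (ex_intro _ _ (bounded_rel_tame f))).

Lemma bounded_of_tameK H1 H2 :
  cancel (@bounded_of_tame H1 H2) (@tame_of_bounded H1 H2).
Proof.
by move=> r; apply: tame_ext => x y; rewrite bounded_relE; exact: ip_lower.
Qed.

Lemma tame_of_boundedK H1 H2 :
  cancel (@tame_of_bounded H1 H2) (@bounded_of_tame H1 H2).
Proof.
move=> f; apply: blin_ext => x /=.
have fP : is_tame (tame_of_bounded f) f (adjoint f) := bounded_rel_tame f.
by have [<-] := is_tame_unique fP.
Qed.

Lemma bounded_of_tame_functor :
  @is_dagger_functor (TRel R) (Hilb R) id bounded_of_tame.
Proof.
split=> [A|A B E g f|A B f] /=.
- by apply: blin_ext => x; exact: lower_id.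
- by apply: blin_ext => x; exact: lower_comp.
(* The lower map of the dagger is [upper f], which satisfies the equation that characterises the
   adjoint. *)
- apply: adjoint_unique => x y.
  by rewrite /= lower_dagger ip_lower ip_upper.
Qed.

(** Since [bounded_of_tame] is injective, each law can be checked after applying it, where it
    reduces to the law already known for that map. *)
Lemma tame_of_bounded_functor :
  @is_dagger_functor (Hilb R) (TRel R) id tame_of_bounded.
Proof.
have [Pi Pc Pd] := bounded_of_tame_functor.
split=> [A|A B E g f|A B f]; apply: (can_inj (@bounded_of_tameK _ _)).
- by rewrite tame_of_boundedK Pi.
- by rewrite Pc !tame_of_boundedK.
- by rewrite Pd !tame_of_boundedK.
Qed.

End Correspondence.

(** Both functors share the object map [Fo], so their actions on morphisms have the same type and
    are compared without transport. *)
Lemma dagger_functor_ext (C D : dagger_category) (Fo : C -> D)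
    (F G : forall A B : C, Defs.Hom A B -> Defs.Hom (Fo A) (Fo B))
    (FP : is_dagger_functor F) (GP : is_dagger_functor G) :
  (forall A B, F A B =1 G A B) -> DaggerFunctor FP = DaggerFunctor GP.
Proof.
move=> FG; have {}FG : F = G.
  by apply: functional_extensionality_dep => A;
    apply: functional_extensionality_dep => B; apply: funext.
by case: _ / FG GP => GP; rewrite (Prop_irrelevance FP GP).
Qed.

Theorem lemma4p6 (R : realType) :
  exists Phi : forall H1 H2 : hilbert R,
      tame_relation H1 H2 -> bounded_linear H1 H2,
    [/\ forall H1 H2 : hilbert R, bijective (Phi H1 H2),
        forall (H1 H2 : hilbert R) (r : tame_relation H1 H2),
          blin (Phi H1 H2 r) = lower r
      & exists PhiP : @is_dagger_functor (TRel R) (Hilb R) id Phi,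
          dagger_isomorphism (DaggerFunctor PhiP)].
Proof.
exists (@bounded_of_tame R); split=> [H1 H2|//|].
  exact: Bijective (@bounded_of_tameK R H1 H2) (@tame_of_boundedK R H1 H2).
exists (@bounded_of_tame_functor R).
exists (DaggerFunctor (@tame_of_bounded_functor R)).
split; apply: dagger_functor_ext => A B f; rewrite /=.
  exact: bounded_of_tameK.
exact: tame_of_boundedK.
Qed.
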